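(* For every graph $F$ on $5$ vertices, $D[F] \geq 4$.
   Context: All graphs are finite simple graphs. Consider first-order logic over graphs whose signature consists of two binary predicate symbols: $\sim$ (adjacency) and $=$ (equality). For a graph $F$, let $\mathcal{C}[F]$ be the property (class of graphs) of containing an induced subgraph isomorphic to $F$. A sentence $\varphi$ expresses $\mathcal{C}[F]$ if for every graph $G$: $G \models \varphi \iff G \in \mathcal{C}[F]$. $D[F]$ denotes the minimal quantifier depth (maximal length of a chain of nested quantifiers) of a first-order sentence expressing $\mathcal{C}[F]$. *)

(* Defs.v *)
From HB Require Import structures.
From mathcomp Require Import all_boot.
From mathcomp Require Import boolp.

Set Implicit Arguments.
Unset Strict Implicit.
Unset Printing Implicit Defensive.

Record graph := Graph {
  vertex :> finType;
  adj : rel vertex;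
  adj_sym : symmetric adj;
  adj_irrefl : irreflexive adj
}.

Definition graph_iso (F G : graph) : Prop :=
  exists2 f : F -> G, bijective f & forall x y : F, adj (f x) (f y) = adj x y.

Section Induced.
Variables (G : graph) (S : {set G}).

Definition induced_adj : rel {x : G | x \in S} :=
  fun x y => adj (val x) (val y).

Lemma induced_adj_sym : symmetric induced_adj.
Proof. by move=> x y; apply: adj_sym. Qed.

Lemma induced_adj_irrefl : irreflexive induced_adj.
Proof. by move=> x; apply: adj_irrefl. Qed.

Definition induced : graph :=
  @Graph {x : G | x \in S} induced_adj induced_adj_sym induced_adj_irrefl.
End Induced.

(* The class C[F]. *)
Definition contains_induced (F G : graph) : Prop :=
  exists S : {set G}, graph_iso F (induced S).

(* [formula n] is the type of first-order formulas whose free variables are    *)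
(* among n de Bruijn variables; a quantifier binds the variable 0 of its body. *)
Inductive formula : nat -> Type :=
| FFalse n : formula n
| FAdj n (i j : 'I_n) : formula n
| FEq n (i j : 'I_n) : formula n
| FNot n (a : formula n) : formula n
| FAnd n (a b : formula n) : formula n
| FOr n (a b : formula n) : formula n
| FImp n (a b : formula n) : formula n
| FEx n (a : formula n.+1) : formula n
| FAll n (a : formula n.+1) : formula n.

Arguments FFalse {n}.

Definition sentence := formula 0.

Fixpoint qdepth n (a : formula n) : nat :=
  match a with
  | FFalse _ | FAdj _ _ _ | FEq _ _ _ => 0
  | FNot _ a => qdepth a
  | FAnd _ a b | FOr _ a b | FImp _ a b => maxn (qdepth a) (qdepth b)
  | FEx _ a | FAll _ a => (qdepth a).+1
  end.

Definition env_cons (T : Type) n (x : T) (v : 'I_n -> T) : 'I_n.+1 -> T :=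
  fun i => if unlift ord0 i is Some j then v j else x.

Fixpoint sat (G : graph) n (a : formula n) : ('I_n -> G) -> bool :=
  match a with
  | FFalse _ => fun _ => false
  | FAdj _ i j => fun v => adj (v i) (v j)
  | FEq _ i j => fun v => v i == v j
  | FNot _ a => fun v => ~~ sat a v
  | FAnd _ a b => fun v => sat a v && sat b v
  | FOr _ a b => fun v => sat a v || sat b v
  | FImp _ a b => fun v => sat a v ==> sat b v
  | FEx _ a => fun v => [exists x : G, sat a (env_cons x v)]
  | FAll _ a => fun v => [forall x : G, sat a (env_cons x v)]
  end.

Definition env_nil (T : Type) : 'I_0 -> T :=
  fun i => False_rect T (notF (ltn_ord i)).

Definition models (G : graph) (a : sentence) : bool := sat a (@env_nil G).

Definition expresses (a : sentence) (F : graph) : Prop :=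
  forall G : graph, models G a <-> contains_induced F G.

(* C[F] is expressible: quantify existentially over #|F| vertices and describe *)
(* all equalities and adjacencies between them.                                *)
Section Expressible.

Fixpoint close n : formula n -> sentence :=
  match n with
  | 0 => id
  | m.+1 => fun a => close (FEx a)
  end.

Lemma models_close (G : graph) n (a : formula n) :
  models G (close a) <-> exists v : 'I_n -> G, sat a v.
Proof.
elim: n a => [|n IHn] a /=.
  split=> [Ga|[v]]; first by exists (@env_nil G).
  by rewrite (_ : v = @env_nil G) //; apply/funext => -[].
rewrite IHn /=; split=> [[v /existsP[x Hx]]|[v Hv]].
  by exists (env_cons x v).
exists (fun i => v (lift ord0 i)); apply/existsP; exists (v ord0).
rewrite (_ : env_cons _ _ = v) //; apply/funext => i.
by rewrite /env_cons; case: unliftP => [j ->|->].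
Qed.

Definition conj n (s : seq (formula n)) : formula n :=
  foldr (@FAnd n) (FNot FFalse) s.

Lemma sat_conj (G : graph) n (s : seq (formula n)) (v : 'I_n -> G) :
  sat (conj s) v = all (fun a => sat a v) s.
Proof. by elim: s => //= a s ->. Qed.

Definition literal n (b : bool) (a : formula n) := if b then a else FNot a.

Lemma sat_literal (G : graph) n b (a : formula n) (v : 'I_n -> G) :
  sat (literal b a) v = (sat a v == b).
Proof. by case: b => /=; case: (sat a v). Qed.

Definition diagram (F : graph) : formula #|F| :=
  conj [seq FAnd (literal (p.1 == p.2) (FEq p.1 p.2))
                 (literal (adj (enum_val p.1) (enum_val p.2)) (FAdj p.1 p.2))
       | p <- enum {: 'I_#|F| * 'I_#|F|}].

Lemma sat_diagram (F G : graph) (v : 'I_#|F| -> G) :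
  sat (diagram F) v <->
  injective v /\ forall i j, adj (v i) (v j) = adj (enum_val i) (enum_val j).
Proof.
rewrite sat_conj all_map; split=> [/allP H|[vI vA]].
  have {}H i j : ((v i == v j) == (i == j)) &&
                 (adj (v i) (v j) == adj (enum_val i) (enum_val j)).
    by have /= := H (i, j) (mem_enum _ _); rewrite !sat_literal.
  split=> [i j|i j]; last by have /andP[_ /eqP] := H i j.
  by have /andP[/eqP Hij _] := H i j => vij; apply/eqP; rewrite -Hij vij.
apply/allP => -[i j] _ /=; rewrite !sat_literal /= vA eqxx andbT.
by rewrite (inj_eq vI).
Qed.

Lemma contains_inducedP (F G : graph) :
  contains_induced F G <->
  exists2 f : F -> G, injective f & forall x y, adj (f x) (f y) = adj x y.
Proof.
split=> [[S [f fB fA]]|[f fI fA]].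
  exists (fun x => val (f x)) => [x y /val_inj|x y]; last exact: fA.
  exact: bij_inj.
have fS x : f x \in f @: [set: F] by rewrite imset_f.
exists (f @: [set: F]).
exists (fun x => exist (fun y => y \in f @: [set: F]) (f x) (fS x)) => //.
apply: inj_card_bij => [x y [/fI]//|].
by rewrite card_sig -(cardsT F) -(card_imset _ fI).
Qed.

Lemma expressible (F : graph) : exists a : sentence, expresses a F.
Proof.
exists (close (diagram F)) => G; rewrite models_close contains_inducedP.
split=> [[v /sat_diagram[vI vA]]|[f fI fA]].
  exists (fun x => v (enum_rank x)) => [x y /vI/enum_rank_inj//|x y].
  by rewrite vA !enum_rankK.
exists (fun i => f (enum_val i)); apply/sat_diagram.
by split=> [i j /fI/enum_val_inj|i j].
Qed.

End Expressible.

Definition expressible_depth (F : graph) : pred nat :=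
  fun d => `[< exists2 a : sentence, expresses a F & qdepth a = d >].

Lemma expressible_depth_ex (F : graph) : exists d, expressible_depth F d.
Proof.
by have [a Ha] := expressible F; exists (qdepth a); apply/asboolP; exists a.
Qed.

(* D[F] *)
Definition min_depth (F : graph) : nat := ex_minn (expressible_depth_ex F).

(* Main.v *)
Require Import Defs.
From mathcomp Require Import all_boot.
From mathcomp Require Import boolp.

(** Call a graph k-extensible if any prescribed adjacencies to at most k vertices
    are realised by a further vertex. Duplicator wins the (k+1)-round
    Ehrenfeucht-Fraisse game on two k-extensible graphs, so D[F] >= 4 as soon as
    some 2-extensible graph contains F and another one omits it. The circulant
    graph on Z/25 with connections 2, 3, 4, 5, 8, 10 is 2-extensible and contains
    every graph on 5 vertices. The 3x3 rook's graph and the circulant graph on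
    Z/13 with connections 1, 2, 4 are 2-extensible too, and the only 5-vertex
    graphs they have in common are P5, the house and the bull. These are prime
    and different from C5, so they do not occur in the lexicographic product
    C5[C5], which is also 2-extensible. *)

Set Implicit Arguments.
Unset Strict Implicit.
Unset Printing Implicit Defensive.

(** * Extension properties and the Ehrenfeucht-Fraisse game *)

Definition extensible k (G : graph) : Prop :=
  forall (s : seq G) (b : pred G), size s <= k ->
  exists2 z, z \notin s & {in s, forall x, adj z x = b x}.

Definition partial_iso (G H : graph) n (v : 'I_n -> G) (w : 'I_n -> H) : Prop :=
  (forall i j, (v i == v j) = (w i == w j)) /\
  (forall i j, adj (v i) (v j) = adj (w i) (w j)).

Lemma partial_iso_sym (G H : graph) n (v : 'I_n -> G) (w : 'I_n -> H) :
  partial_iso v w -> partial_iso w v.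
Proof. by case=> vwE vwA; split=> i j; rewrite ?vwE ?vwA. Qed.

Lemma partial_iso_cons (G H : graph) n (v : 'I_n -> G) (w : 'I_n -> H) x y :
  partial_iso v w -> (forall i, (x == v i) = (y == w i)) ->
  (forall i, adj x (v i) = adj y (w i)) ->
  partial_iso (env_cons x v) (env_cons y w).
Proof.
move=> [vwE vwA] xyE xyA; split=> i j; rewrite /env_cons.
  case: (unliftP ord0 i) => [i' _|_]; case: (unliftP ord0 j) => [j' _|_] //=.
    by rewrite eq_sym xyE eq_sym.
  by rewrite !eqxx.
case: (unliftP ord0 i) => [i' _|_]; case: (unliftP ord0 j) => [j' _|_] //=.
  by rewrite adj_sym xyA adj_sym.
by rewrite !adj_irrefl.
Qed.

(** Duplicator's reply: if [x] is already listed, its partner is repeated; otherwise extensibility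
    of [H] is applied to the at most [k] vertices of [w]. *)
Lemma extend_partial_iso k (G H : graph) n (v : 'I_n -> G) (w : 'I_n -> H) x :
  extensible k H -> n <= k -> partial_iso v w ->
  exists y, partial_iso (env_cons x v) (env_cons y w).
Proof.
move=> extH le_nk vw; have [vwE vwA] := vw.
case: (pickP (fun i => x == v i)) => [i /eqP-> | xNv].
  by exists (w i); apply: partial_iso_cons.
have [|z zNw zA] :=
  extH (codom w) (fun y => [exists i, (y == w i) && adj x (v i)]).
  by rewrite size_codom card_ord.
exists z; apply: partial_iso_cons => // i.
  rewrite xNv; apply/esym/negbTE; apply: contraNneq zNw => ->.
  exact: codom_f.
rewrite zA ?codom_f //; apply/idP/existsP => [xv|[j /andP[]]].
  by exists i; rewrite eqxx.
by rewrite -vwE => /eqP->.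
Qed.

(** The sum [n + qdepth a] is unchanged on passing under a quantifier, and its bound gives [n <= k]
    there, so a reply exists. *)
Lemma extensible_sat k (G H : graph) n (a : formula n)
    (v : 'I_n -> G) (w : 'I_n -> H) :
  extensible k G -> extensible k H -> n + qdepth a <= k.+1 ->
  partial_iso v w -> sat a v = sat a w.
Proof.
move=> extG extH.
elim: a v w => {n} //= [n i j|n i j|n a IHa|n a IHa b IHb|n a IHa b IHb
                       |n a IHa b IHb|n a IHa|n a IHa] v w.
- by move=> _ [_ ->].
- by move=> _ [->].
- by move=> le_k vw; rewrite (IHa _ w).
- rewrite addn_maxr geq_max => /andP[leA leB] vw.
  by rewrite (IHa _ w) // (IHb _ w).
- rewrite addn_maxr geq_max => /andP[leA leB] vw.
  by rewrite (IHa _ w) // (IHb _ w).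
- rewrite addn_maxr geq_max => /andP[leA leB] vw.
  by rewrite (IHa _ w) // (IHb _ w).
- rewrite addnS -addSn => le_k vw.
  have le_nk : n <= k by rewrite -ltnS; apply: leq_trans le_k; apply: leq_addr.
  apply/existsP/existsP => [[x ax]|[y ay]].
    have [y xy] := extend_partial_iso x extH le_nk vw.
    by exists y; rewrite -(IHa _ _ le_k xy).
  have [x /partial_iso_sym xy] :=
    extend_partial_iso y extG le_nk (partial_iso_sym vw).
  by exists x; rewrite (IHa _ _ le_k xy).
- rewrite addnS -addSn => le_k vw.
  have le_nk : n <= k by rewrite -ltnS; apply: leq_trans le_k; apply: leq_addr.
  apply/forallP/forallP => [av y|aw x].
    have [x /partial_iso_sym xy] :=
      extend_partial_iso y extG le_nk (partial_iso_sym vw).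
    by rewrite -(IHa _ _ le_k xy).
  have [y xy] := extend_partial_iso x extH le_nk vw.
  by rewrite (IHa _ _ le_k xy).
Qed.

Lemma extensible_models k (G H : graph) (a : sentence) :
  extensible k G -> extensible k H -> qdepth a <= k.+1 ->
  models G a = models H a.
Proof.
by move=> extG extH ak; apply: (extensible_sat extG extH) => //; split=> -[].
Qed.

Lemma min_depth_gt k (F G H : graph) :
  extensible k G -> extensible k H ->
  contains_induced F G -> ~ contains_induced F H -> k.+1 < min_depth F.
Proof.
move=> extG extH FG FH; rewrite /min_depth; case: ex_minnP => d.
move=> /asboolP[a aF <-] _; rewrite ltnNge; apply/negP => ak.
by apply/FH/aF; rewrite -(extensible_models extG extH ak); apply/aF.
Qed.

(** * Search for induced subgraphs by adjacency patterns *)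

(* [has] with a conditional in place of [orb], so that a call-by-value *)
(* evaluation stops at the first witness.                              *)
Fixpoint has_first (T : Type) (p : pred T) (s : seq T) : bool :=
  if s is x :: s' then if p x then true else has_first p s' else false.

Lemma has_firstE (T : Type) (p : pred T) s : has_first p s = has p s.
Proof. by elim: s => //= x s ->. Qed.

Section Pattern.
Variables (T : eqType) (e : rel T).

(* The adjacencies of each element of [s] to the ones before it, latest first; *)
(* [acc] holds the elements already read, in reverse order.                    *)
Fixpoint pattern (acc s : seq T) : seq bitseq :=
  if s is x :: s' then [seq e x y | y <- acc] :: pattern (x :: acc) s'
  else [::].

Fixpoint embeds (V : seq T) (p : seq bitseq) (acc : seq T) : bool :=
  if p is r :: p' then
    has_first (fun x =>
      if x \in acc then false else
      if [seq e x y | y <- acc] == r then embeds V p' (x :: acc) else false) V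
  else true.

Lemma size_pattern acc s : size (pattern acc s) = size s.
Proof. by elim: s acc => //= x s IHs acc; rewrite IHs. Qed.

Lemma embedsP V p acc : uniq acc ->
  reflect (exists t, [/\ {subset t <= V}, uniq (catrev t acc)
                       & pattern acc t = p])
          (embeds V p acc).
Proof.
elim: p acc => [|r p IHp] acc accU /=.
  by apply: (iffP idP) => // _; exists [::].
rewrite has_firstE.
apply: (iffP hasP) => [[x xV]|[[|x t] [//= tV tU [rE pE]]]].
  case: ifPn => // xacc; case: eqP => // rE /IHp[|t [tV tU pE]].
    by rewrite /= xacc.
  exists (x :: t); split=> //=; last by rewrite rE pE.
  by move=> y; rewrite inE => /predU1P[->|/tV].
exists x; first by apply: tV; rewrite mem_head.
have xaccU : uniq (x :: acc) by move: tU; rewrite catrevE cat_uniq => /and3P[].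
have /= /andP[/negbTE-> _] := xaccU.
rewrite rE eqxx; apply/IHp => //; exists t; split=> // y yt.
by apply: tV; rewrite inE yt orbT.
Qed.

End Pattern.

Lemma pattern_map (T U : eqType) (e : rel T) (e' : rel U) (f : T -> U) acc s :
  (forall x y, e' (f x) (f y) = e x y) ->
  pattern e' [seq f x | x <- acc] [seq f x | x <- s] = pattern e acc s.
Proof.
move=> fA; elim: s acc => //= x s IHs acc.
by rewrite -map_comp -IHs; congr (_ :: _); apply: eq_map => y /=.
Qed.

(** [catrev acc s] is the whole list in reading order; it stays the same when the head of [s] moves
    to [acc]. *)
Lemma pattern_nth (T U : eqType) (e : rel T) (e' : rel U) x0 y0 acc acc' s t :
  pattern e acc s = pattern e' acc' t -> size acc = size acc' ->
  forall i j, i < size s -> j < size acc + i ->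
  e (nth x0 s i) (nth x0 (catrev acc s) j) =
  e' (nth y0 t i) (nth y0 (catrev acc' t) j).
Proof.
elim: s t acc acc' => [|x s IHs] [|y t] //= acc acc' [rE pE] accE [|i] j.
  move=> _; rewrite addn0 => jacc /=.
  rewrite !catrevE !nth_cat !size_rev -accE jacc !nth_rev -?accE //.
  (* Rows start with the latest element, so position [j] in reading order is entry
     [size acc - j.+1]. *)
  have lt_acc : size acc - j.+1 < size acc.
    by rewrite ltn_subrL /=; apply: leq_ltn_trans jacc.
  have /(congr1 (fun r => nth false r (size acc - j.+1))) := rE.
  by rewrite (nth_map x0) // (nth_map y0) -?accE.
rewrite ltnS => ins jai; apply: (IHs t (x :: acc) (y :: acc')) => //=.
  by rewrite accE.
by rewrite addSn -addnS.
Qed.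

(** [t] lists the images of [enum F] in order. Rows cover each pair of distinct vertices once;
    symmetry and irreflexivity settle the rest. *)
Lemma contains_induced_pattern (F G : graph) :
  contains_induced F G <->
  exists t : seq G, uniq t /\
    pattern (@adj G) [::] t = pattern (@adj F) [::] (enum F).
Proof.
rewrite contains_inducedP; split=> [[f fI fA]|[t [tU tE]]].
  exists [seq f x | x <- enum F]; rewrite map_inj_uniq // enum_uniq.
  by split=> //; apply: (pattern_map [::]).
have sz_t : size t = #|F|.
  by rewrite -(size_pattern (@adj G) [::]) tE size_pattern cardE.
case: t => [|y0 t'] in tU tE sz_t *.
  have F0 (x : F) : False by apply: (fintype0 x); rewrite -sz_t.
  by exists (fun x => match F0 x with end) => x; case: (F0 x).
set t := y0 :: t' in tU tE sz_t *.
have idx (x : F) : index x (enum F) < size t.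
  by rewrite sz_t cardE index_mem mem_enum.
exists (fun x => nth y0 t (index x (enum F))) => x y.
  move/eqP; rewrite nth_uniq // => /eqP/(congr1 (nth x (enum F))).
  by rewrite !nth_index ?mem_enum.
wlog lt_yx : x y / index y (enum F) < index x (enum F).
  move=> IH; case: (ltngtP (index y (enum F)) (index x (enum F))) => [|lt|xyE].
  - exact: IH.
  - by rewrite adj_sym IH // adj_sym.
  - rewrite xyE adj_irrefl -(nth_index x (mem_enum F x)).
    by rewrite -xyE nth_index ?mem_enum // adj_irrefl.
have -> := pattern_nth y0 x tE (erefl _) (idx x) lt_yx.
by rewrite /= !nth_index ?mem_enum.
Qed.

(** * Graphs given by Boolean matrices *)

Definition entry (M : seq bitseq) i j : bool := nth false (nth [::] M i) j.

(* Only the entries above the diagonal of [M] matter. *)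
Definition matrix_adj (M : seq bitseq) : rel nat :=
  fun i j => if i < j then entry M i j else if j < i then entry M j i else false.

Lemma matrix_adj_sym M : symmetric (matrix_adj M).
Proof. by move=> i j; rewrite /matrix_adj; case: (ltngtP i j). Qed.

Lemma matrix_adj_irrefl M : irreflexive (matrix_adj M).
Proof. by move=> i; rewrite /matrix_adj ltnn. Qed.

Definition matrix_graph (M : seq bitseq) : graph :=
  @Graph 'I_(size M) (fun i j => matrix_adj M i j)
    (fun i j => matrix_adj_sym M i j) (fun i => matrix_adj_irrefl M i).

Definition matrix_embeds (M : seq bitseq) (p : seq bitseq) : bool :=
  embeds (matrix_adj M) (iota 0 (size M)) p [::].

Lemma matrix_graph_contains (F : graph) M :
  contains_induced F (matrix_graph M) <->
  matrix_embeds M (pattern (@adj F) [::] (enum F)).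
Proof.
rewrite contains_induced_pattern; split=> [[t [tU tE]]|/embedsP[]// t [tV tU tE]].
  apply/embedsP => //; exists [seq val i | i <- t]; split.
  - by move=> _ /mapP[i _ ->]; rewrite mem_iota ltn_ord.
  - by rewrite catrevE cats0 rev_uniq map_inj_uniq //; apply: val_inj.
  - by rewrite -tE; apply: (@pattern_map _ _ (@adj (matrix_graph M)) _ val [::]).
have tE' : [seq val i | i <- pmap (insub : nat -> option 'I_(size M)) t] = t.
  rewrite (pmap_filter (insubK _)); apply/all_filterP/allP => i /tV.
  by rewrite mem_iota isSome_insub.
exists (pmap (insub : nat -> option 'I_(size M)) t); split.
  by apply: pmap_sub_uniq; rewrite catrevE cats0 rev_uniq in tU.
rewrite -tE -[in RHS]tE'.
by apply/esym/(@pattern_map _ _ (@adj (matrix_graph M)) _ val [::]).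
Qed.

(** Pairs suffice, since shorter lists can be padded by repetition; contradictory demands on a
    repeated vertex are skipped. *)
Definition extensible2b (M : seq bitseq) : bool :=
  let V := iota 0 (size M) in let e := matrix_adj M in
  all (fun x => all (fun y => all (fun a => all (fun b =>
    if (x == y) && (a != b) then true else
    has (fun z => [&& z != x, z != y, e z x == a & e z y == b]) V)
  [:: true; false]) [:: true; false]) V) V.

Lemma matrix_graph_extensible M :
  0 < size M -> extensible2b M -> extensible 2 (matrix_graph M).
Proof.
move=> M_gt0 /allP extM.
have {}extM (x y : matrix_graph M) (b : pred (matrix_graph M)) :
    exists2 z, z \notin [:: x; y] & {in [:: x; y], forall u, adj z u = b u}.
  have inV (i : 'I_(size M)) : val i \in iota 0 (size M) by rewrite mem_iota /=.
  have /allP/(_ _ (inV y))/allP/(_ (b x)) := extM _ (inV x).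
  have in2 (c : bool) : c \in [:: true; false] by case: c.
  move=> /(_ (in2 _))/allP/(_ (b y) (in2 _)); case: ifP.
    by case/andP=> /eqP/val_inj->; rewrite eqxx.
  move=> _ /hasP[z]; rewrite mem_iota add0n => /andP[_ ltz].
  case/and4P=> zx zy /eqP zA /eqP zB; exists (Ordinal ltz : matrix_graph M).
    by rewrite !inE -!val_eqE /= (negbTE zx) (negbTE zy).
  by move=> u; rewrite !inE => /orP[]/eqP->.
case=> [|x [|y [|//]]] b _.
- have [z _ _] := extM (Ordinal M_gt0) (Ordinal M_gt0) b.
  by exists z.
- have [z zN zA] := extM x x b; exists z; first by move: zN; rewrite !inE orbb.
  by move=> u ux; apply: zA; rewrite in_cons ux orbT.
- exact: extM.
Qed.

(** Moves the pattern from ordinals to natural numbers, where it can be evaluated. *)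
Lemma pattern_matrix_graph M :
  pattern (@adj (matrix_graph M)) [::] (enum (matrix_graph M)) =
  pattern (matrix_adj M) [::] (iota 0 (size M)).
Proof.
rewrite -(val_enum_ord (size M)).
by apply/esym/(@pattern_map _ _ (@adj (matrix_graph M)) _ val [::]).
Qed.

(** * Composing and inverting embeddings; the list of all patterns *)

Lemma contains_induced_trans (F G H : graph) :
  contains_induced F G -> contains_induced G H -> contains_induced F H.
Proof.
rewrite !contains_inducedP => -[f fI fA] [g gI gA]; exists (g \o f).
  exact: inj_comp.
by move=> x y; rewrite /= gA fA.
Qed.

Lemma contains_induced_inv (F G : graph) :
  #|F| = #|G| -> contains_induced F G -> contains_induced G F.
Proof.
move=> FG; rewrite !contains_inducedP => -[f fI fA].
have [|g fK gK] := @inj_card_bij _ _ f fI; first by rewrite FG.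
by exists g => [|x y]; [apply: can_inj gK | rewrite -fA !gK].
Qed.

Fixpoint bitseqs k : seq bitseq :=
  if k is k'.+1 then [seq b :: r | b <- [:: true; false], r <- bitseqs k']
  else [:: [::]].

Lemma mem_bitseqs r : r \in bitseqs (size r).
Proof. by elim: r => // b r; apply: (@allpairs_f _ _ _ cons); case: b. Qed.

(** [k] counts the vertices already read, so the rows have lengths [k], [k.+1] and so on;
    [patterns 0 5] encodes the 1024 labelled graphs on 5 vertices. *)
Fixpoint patterns k n : seq (seq bitseq) :=
  if n is n'.+1 then [seq r :: p | r <- bitseqs k, p <- patterns k.+1 n']
  else [:: [::]].

Lemma mem_patterns (T : eqType) (e : rel T) acc s :
  pattern e acc s \in patterns (size acc) (size s).
Proof.
elim: s acc => // x s IHs acc; apply: (@allpairs_f _ _ _ cons); last exact: IHs.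
by rewrite -(size_map (e x)) mem_bitseqs.
Qed.

(** * The witness graphs and their verification by computation *)

Definition tabulate n (e : rel nat) : seq bitseq :=
  mkseq (fun i => mkseq (e i) n) n.

Definition circulant n (D : seq nat) : seq bitseq :=
  tabulate n (fun i j => (j - i \in D) || (n - (j - i) \in D)).

Definition rook3 : seq bitseq :=
  tabulate 9 (fun i j => (i %/ 3 == j %/ 3) || (i %% 3 == j %% 3)).

Definition circ13 : seq bitseq := circulant 13 [:: 1; 2; 4].

Definition circ25 : seq bitseq := circulant 25 [:: 2; 3; 4; 5; 8; 10].

(* The lexicographic product C5[C5], whose fibres are the classes modulo 5. *)
Definition C5_lex_C5 : seq bitseq := circulant 25 [:: 1; 4; 5; 6; 9; 11].

Definition of_edges n (E : seq (nat * nat)) : seq bitseq :=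
  tabulate n (fun i j => (i, j) \in E).

Definition P5 : seq bitseq :=
  of_edges 5 [:: (0, 1); (1, 2); (2, 3); (3, 4)].

Definition house : seq bitseq :=
  of_edges 5 [:: (0, 1); (1, 2); (2, 3); (0, 3); (0, 4); (1, 4)].

Definition bull : seq bitseq :=
  of_edges 5 [:: (0, 1); (1, 2); (0, 2); (0, 3); (1, 4)].

Lemma rook3_extensible : extensible 2 (matrix_graph rook3).
Proof. by apply: matrix_graph_extensible; vm_compute. Qed.

Lemma circ13_extensible : extensible 2 (matrix_graph circ13).
Proof. by apply: matrix_graph_extensible; vm_compute. Qed.

Lemma circ25_extensible : extensible 2 (matrix_graph circ25).
Proof. by apply: matrix_graph_extensible; vm_compute. Qed.

Lemma C5_lex_C5_extensible : extensible 2 (matrix_graph C5_lex_C5).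
Proof. by apply: matrix_graph_extensible; vm_compute. Qed.

Lemma circ25_universal : all (matrix_embeds circ25) (patterns 0 5).
Proof. by vm_compute. Qed.

Lemma circ25_contains (F : graph) :
  #|F| = 5 -> contains_induced F (matrix_graph circ25).
Proof.
move=> F5; apply/matrix_graph_contains; apply: (allP circ25_universal).
by rewrite -F5 cardE mem_patterns.
Qed.

(** The three listed graphs have 5 vertices, so containing a pattern with 5 rows means being
    isomorphic to it. *)
Lemma rook3_circ13_patterns :
  all (fun p => if matrix_embeds rook3 p then
                  if matrix_embeds circ13 p then
                    has_first (matrix_embeds^~ p) [:: P5; house; bull]
                  else true
                else true) (patterns 0 5).
Proof. by vm_compute. Qed.

Lemma rook3_circ13_common (F : graph) :
  #|F| = 5 -> contains_induced F (matrix_graph rook3) ->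
  contains_induced F (matrix_graph circ13) ->
  exists2 M, M \in [:: P5; house; bull] & contains_induced F (matrix_graph M).
Proof.
move=> F5 /matrix_graph_contains Frook /matrix_graph_contains Fcirc.
have := allP rook3_circ13_patterns (pattern (@adj F) [::] (enum F)).
rewrite Frook Fcirc has_firstE -[5]F5 cardE mem_patterns => /(_ isT)/hasP[M MP].
by move=> /matrix_graph_contains FM; exists M.
Qed.

(* A copy of F in C5[C5] meets each fibre in a module of F; if F is prime, it  *)
(* lies in one fibre or meets every fibre once, and is a C5.                   *)
Lemma C5_lex_C5_patterns :
  all (fun M => ~~ matrix_embeds C5_lex_C5
                     (pattern (matrix_adj M) [::] (iota 0 (size M))))
      [:: P5; house; bull].
Proof. by vm_compute. Qed.

Lemma C5_lex_C5_omits M :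
  M \in [:: P5; house; bull] ->
  ~ contains_induced (matrix_graph M) (matrix_graph C5_lex_C5).
Proof.
move=> MP /matrix_graph_contains; rewrite pattern_matrix_graph.
exact/negP/(allP C5_lex_C5_patterns).
Qed.

Theorem theorem4 (F : graph) (hF : #|F| = 5) : 4 <= min_depth F.
Proof.
(* [circ25] always serves as the graph containing [F]; only one omitting [F] remains to be found. *)
have omit H : extensible 2 H -> ~ contains_induced F H -> 4 <= min_depth F.
  move=> extH; apply: (min_depth_gt circ25_extensible extH).
  exact: circ25_contains.
have [Frook|] := pselect (contains_induced F (matrix_graph rook3)); last first.
  exact: omit rook3_extensible.
have [Fcirc|] := pselect (contains_induced F (matrix_graph circ13)); last first.
  exact: omit circ13_extensible.
have [M MP FM] := rook3_circ13_common hF Frook Fcirc.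
apply: (omit _ C5_lex_C5_extensible) => FC; apply: (C5_lex_C5_omits MP).
(* [F] and [M] both have 5 vertices, so the embedding of [F] in [M] can be inverted. *)
apply: contains_induced_trans FC; apply: contains_induced_inv FM.
rewrite hF card_ord; move: MP; rewrite !inE.
by case/or3P=> /eqP->; rewrite size_mkseq.
Qed.
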